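(* Let $\mathbf{w} = (w_1, w_2, \ldots)$ be a sequence of words in $A^+$ (with $A=\{a,b\}$) such that for every $n\in\mathbb{N}$ there are no $s, t, v \in A^*$ with $w_n = stv$ and $st, tv \in S_{\mathbf{w}}$. For each $n$, let $p_n$ and $s_n$ be respectively the longest prefix and the longest suffix of $w_n$ belonging to $S_{\mathbf{w}}$, and let $u_n\in A^*$ be such that $w_n = p_n u_n s_n$. Suppose that for all $n,m\in\mathbb{N}$, $u_n$ is a subword of $w_m$ if and only if $n = m$, and that $u_n$ is not a subword of $p_n$ for all $n$. Then $(w_1, w_2, \ldots)$ is a universal sequence for $X^X$ for every infinite set $X$.
   Context: $A = \{a,b\}$; $A^*$ is the free monoid on $A$ with empty word $\varepsilon$ (a prefix and suffix of every word), and $A^+ = A^*\setminus\{\varepsilon\}$. For a sequence $\mathbf{w}=(w_1,w_2,\ldots)$ in $A^+$, $S_{\mathbf{w}}$ is the least submonoid $S$ of $A^*$ satisfying: (C1) if $w_n = s v u v s'$ for some $n$, with $s, s' \in S$ and $u, v \in A^*$, then $v \in S$; (C2) if $w_m = s v t$ and $w_n = t' v s'$ for some $m \neq n$, with $s, s' \in S$ and $t, t', v \in A^*$, then $v \in S$. $X^X$ is the full transformation monoid of all functions $X\to X$ under composition. A sequence $w_1, w_2, \ldots \in A^+$ is universal for a semigroup $T$ if for every sequence $f_1, f_2, \ldots \in T$ there is a semigroup homomorphism $\Phi: A^+ \to T$ with $(w_n)\Phi = f_n$ for all $n$. *)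

(* Defs.v *)
From Stdlib Require List.
From mathcomp Require Import all_boot.
Set Implicit Arguments. Unset Strict Implicit. Unset Printing Implicit Defensive.

(* The alphabet A = {a,b} is encoded as bool (a := false, b := true);
   A^* is seq bool, A^+ its nonempty elements. *)
Definition word := seq bool.

Definition is_submonoid (S : word -> Prop) : Prop :=
  S [::] /\ forall x y, S x -> S y -> S (x ++ y).

Definition cond_C1 (w : nat -> word) (S : word -> Prop) : Prop :=
  forall n s v u s', w n = s ++ v ++ u ++ v ++ s' -> S s -> S s' -> S v.

Definition cond_C2 (w : nat -> word) (S : word -> Prop) : Prop :=
  forall m n s v t t' s', m <> n ->
    w m = s ++ v ++ t -> w n = t' ++ v ++ s' -> S s -> S s' -> S v.

Definition S_w (w : nat -> word) (x : word) : Prop :=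
  forall S : word -> Prop, is_submonoid S -> cond_C1 w S -> cond_C2 w S -> S x.

(* Composition in the full transformation monoid X^X, written with
   functions acting on the right as in the paper: (x)(f g) = ((x)f)g. *)
Definition tcomp (X : Type) (f g : X -> X) : X -> X := fun x => g (f x).

(* Semigroup homomorphism A^+ -> X^X (given on A^*, only its values on
   nonempty words matter). *)
Definition is_semigroup_hom (X : Type) (Phi : word -> (X -> X)) : Prop :=
  forall x y : word, x <> [::] -> y <> [::] -> Phi (x ++ y) = tcomp (Phi x) (Phi y).

Definition universal_for_TX (X : Type) (w : nat -> word) : Prop :=
  forall f : nat -> (X -> X), exists Phi : word -> (X -> X),
    is_semigroup_hom Phi /\ forall n, Phi (w n) = f n.

Definition infinite_type (X : Type) : Prop :=
  ~ exists l : list X, forall x : X, List.In x l.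

(* Main.v *)
(* Let B be the set of irreducible elements of S_w. The closure conditions make
   B bifix, forbid proper overlaps between elements of B, and give each b in B
   an occurrence preceded by an element of S_w in some w_m and a disjoint one
   followed by an element of S_w in some w_n. States are pairs of a base point
   and a reduced word over the letters of A and formal inverses b^-1, where
   "reduced" forbids b b^-1, b^-1 b and every u_n. Reading a letter appends it
   and cancels b^-1 b, so that elements of S_w act bijectively. When the word
   becomes h u_n, the state jumps instead to (F_n (h p_n^-1)) s_n^-1, so that
   reading w_n = p_n u_n s_n applies F_n, provided that no other jump happens
   on the way. If one happened, some nonempty suffix of u_m would follow an
   element of S_w in w_n, and a border of it would extend s_m. Finally X is in
   bijection with the set of states since X x nat embeds in X. *)
Require Import Defs.
From mathcomp Require Import all_boot.
From mathcomp Require Import boolp classical_sets functions cardinality.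
From mathcomp Require Import zify.
Set Implicit Arguments. Unset Strict Implicit. Unset Printing Implicit Defensive.

(** * Cardinality *)

Section Cardinality.
Local Open Scope classical_set_scope.
Local Open Scope card_scope.

Lemma infinite_type_setT (X : Type) : infinite_type X -> infinite_set [set: X].
Proof.
move=> Xinf; elim/Pchoice: X => X in Xinf *.
move=> /finite_seqP[l El]; apply: Xinf; exists l => x.
have : [set: X] x by [].
rewrite El /=.
by elim: l {El} => //= a l IH; rewrite inE => /orP[/eqP->|/IH]; [left|right].
Qed.

(** The case [e = f] makes each sequence injective; the other cases make the ranges disjoint. *)
Definition disjoint_sequences (X : Type) (D : set (nat -> X)) :=
  forall e f, D e -> D f -> forall i j, e i = f j -> e = f /\ i = j.

(** A maximal family of disjoint injective sequences, given by Zorn, misses only finitely many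
    points. Each point then has an address in some sequence, and the factor [nat] is absorbed by
    moving along that sequence. *)
Lemma infinite_nat_prod_inj (X : Type) : infinite_type X ->
  exists f : X * nat -> X, injective f.
Proof.
move=> /infinite_type_setT Xinf.
have [|D [DD Dmax]] := @Zorn_bigcup _ (@disjoint_sequences X).
  move=> G GD Gtot e f [A GA Ae] [B GB Bf] i j.
  have [AB|BA] := Gtot _ _ GA GB; [apply: (GD _ GB) => //; exact: AB|].
  by apply: (GD _ GA) => //; exact: BA.
pose U := [set x | exists2 e, D e & exists i, e i = x].
have UCfin : finite_set (~` U).
  apply: contrapT => /infiniteP/card_leP[e'].
  pose e i := val (e' (SigSub (@mem_set _ setT i I))).
  have einj i j : e i = e j -> i = j.
    by move=> /val_inj/(@inj _ _ _ e' _ _ (mem_set I) (mem_set I)) [].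
  have eU i : ~ U (e i) by exact: (set_mem (valP (e' (SigSub (@mem_set _ setT i I))))).
  apply: (Dmax (e |` D)).
    split; last by move=> h; apply: (eU 0); exists e; [apply: h; left | exists 0].
    by move=> f Df; right.
  move=> f g [->|Df] [->|Dg] i j E.
  - by split => //; exact: einj.
  - by case: (eU i); exists g => //; exists j.
  - by case: (eU j); exists f => //; exists i.
  - exact: DD.
have [e0 De0] : exists e, D e.
  apply: contrapT => nD; apply: Xinf; apply: sub_finite_set UCfin => x _ [e De _].
  by apply: nD; exists e.
have [c cinj] : exists c : X -> nat, {in ~` U &, injective c}.
  exact/countable_injP/finite_set_countable.
(* The finitely many points missed by the family go to odd indices of [e0]. *)
have /choice[code codeP] : forall x : X, exists ei : (nat -> X) * nat,
    D ei.1 /\ (~ U x /\ ei = (e0, (c x).*2.+1) \/ exists2 i, ei.1 i = x & ei.2 = i.*2).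
  move=> x; have [[e De [i ex]]|nU] := pselect (U x).
    by exists (e, i.*2); split => //; right; exists i.
  by exists (e0, (c x).*2.+1); split => //; left.
have codeI : injective code.
  move=> x y E; have [_ Hx] := codeP x; have [_ Hy] := codeP y.
  case: Hx Hy => [[nx Ex]|[i Ei Ei2]] [[ny Ey]|[j Ej Ej2]].
  - by apply: cinj; rewrite ?inE //; apply/double_inj; move: E; rewrite Ex Ey => -[].
  - by have := congr1 odd Ej2; rewrite -E Ex /= odd_double odd_double.
  - by have := congr1 odd Ei2; rewrite E Ey /= odd_double odd_double.
  - by rewrite -Ei -Ej E; congr (_ _); apply/double_inj; rewrite -Ei2 -Ej2 E.
exists (fun xk => (code xk.1).1 (pickle ((code xk.1).2, xk.2))) => -[x k] [y l] /= E.
have [E1 /(pcan_inj (@pickleK _))[E2 ->]] :=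
  DD _ _ (codeP x).1 (codeP y).1 _ _ E.
congr (_, _); apply: codeI; move: E1 E2.
by case: (code x) (code y) => ? ? [? ?] /= -> ->.
Qed.

(** Cantor-Bernstein, with [x] sent to [(x, c0)] one way and the injection of [X * nat] into [X] the
    other way. [A] will be the set of reduced words. *)
Lemma infinite_prod_countable_bij (X : Type) (C : countType) (c0 : C) (A : set C) :
  infinite_type X -> A c0 ->
  exists (f : X -> X * C) (g : X * C -> X),
    [/\ forall x, A (f x).2, cancel f g & forall z, A z.2 -> f (g z) = z].
Proof.
move=> Xinf Ac0; have [h hinj] := infinite_nat_prod_inj Xinf.
have /card_bijP[f [g gK fK]] : [set: X] #= [set z : X * C | A z.2].
  rewrite card_eq_le; apply/andP; split.
    have /injfunPex[k] : exists2 k : X -> X * C,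
        set_fun [set: X] [set z | A z.2] k & set_inj [set: X] k.
      by exists (fun x => (x, c0)) => // x y _ _ [].
    exact: inj_card_le k.
  have /injfunPex[k] : exists2 k : X * C -> X,
      set_fun [set z | A z.2] [set: X] k & set_inj [set z | A z.2] k.
    exists (fun z => h (z.1, pickle z.2)) => // -[x c] [y d] _ _ /hinj[->].
    by move/(pcan_inj (@pickleK _)) ->.
  exact: inj_card_le k.
exists (fun x => val (f (SigSub (@mem_set _ setT x I)))).
(* The value [z.1] outside [A] is a mere default. *)
exists (fun z => if pselect (A z.2) is left Az then val (g (SigSub (mem_set Az))) else z.1).
split=> [x|x|z Az].
- exact: (set_mem (valP (f (SigSub (@mem_set _ setT x I))))).
- case: pselect => [Az|[]]; last exact: (set_mem (valP (f (SigSub (@mem_set _ setT x I))))).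
  by rewrite (_ : SigSub _ = f (SigSub (@mem_set _ setT x I))) ?gK //; apply: val_inj.
- case: pselect => // Az'; rewrite (_ : SigSub (@mem_set _ setT _ I) = g (SigSub (mem_set Az'))) ?fK //.
  exact: val_inj.
Qed.

End Cardinality.

(** * Borders and irreducible elements of S_w *)

Lemma size_gt0 (T : Type) (x : seq T) : x <> [::] -> 0 < size x.
Proof. by case: x. Qed.

Lemma cat_eq_cat (T : Type) (a b c d : seq T) : a ++ b = c ++ d ->
  size a <= size c -> exists2 e, c = a ++ e & b = e ++ d.
Proof.
move=> E le_ac; have Ea : a = take (size a) c.
  by have := congr1 (take (size a)) E; rewrite take_size_cat // takel_cat.
have: c = a ++ drop (size a) c by rewrite {1}Ea cat_take_drop.
move: (drop _ c) => e Ec; exists e => //.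
by have := congr1 (drop (size a)) E; rewrite Ec -catA !drop_size_cat.
Qed.

(* A shortest nonempty border does not overlap itself. *)
Lemma disjoint_border (T : Type) (v t1 t2 : seq T) : v <> [::] -> t2 <> [::] ->
  v ++ t1 = t2 ++ v ->
  exists v0 m a b, [/\ v0 <> [::], v = v0 ++ a, v = b ++ v0 & v ++ t1 = v0 ++ m ++ v0].
Proof.
have [k] := ubnP (size v); elim: k v t1 t2 => // k IH v t1 t2 lek v0 t20 E.
have [le|lt] := leqP (size v) (size t2).
  have [e Et2 _] := cat_eq_cat E le.
  exists v, e, [::], [::]; split; rewrite ?cats0 //.
  by rewrite E Et2 catA.
have [e Ev Ee] := cat_eq_cat (esym E) (ltnW lt).
have szt2 := size_gt0 t20.
have e0 : e <> [::] by move=> e0; move: lt; rewrite Ev e0 cats0 ltnn.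
have szE : size e < size v by rewrite Ev size_cat; lia.
(* Since [v = t2 ++ e = e ++ t1], the shorter word [e] is a border of the same long word:
   [e ++ t1 ++ t1 = v ++ t1 = t2 ++ t2 ++ e]. *)
have [|||v0' [m [a [b [h1 h2 h3 h4]]]]] := IH e (t1 ++ t1) (t2 ++ t2) _ e0.
- by lia.
- by case: (t2) t20.
- by rewrite catA -Ee -!catA -Ev.
exists v0', m, (a ++ t1), (t2 ++ b); split => //.
- by rewrite catA -h2 -Ee.
- by rewrite -catA -h3.
- by rewrite -h4 {1}Ee catA.
Qed.

Lemma infix_cat3 (T : eqType) (a v b : seq T) : infix v (a ++ v ++ b).
Proof. by apply/infixP; exists a, b. Qed.

Lemma S_w_nil w : S_w w [::].
Proof. by move=> S []. Qed.

Lemma S_w_cat w x y : S_w w x -> S_w w y -> S_w w (x ++ y).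
Proof.
by move=> Sx Sy S HS H1 H2; case: (HS) => _; apply; [apply: Sx | apply: Sy].
Qed.

Lemma S_w_C1 w : cond_C1 w (S_w w).
Proof.
by move=> n s v u s' E Ss Ss' S HS H1 H2; apply: (H1 _ _ _ _ _ E); [apply: Ss | apply: Ss'].
Qed.

Lemma S_w_C2 w : cond_C2 w (S_w w).
Proof.
move=> m n s v t t' s' mn Em En Ss Ss' S HS H1 H2.
by apply: (H2 _ _ _ _ _ _ _ mn Em En); [apply: Ss | apply: Ss'].
Qed.

Lemma S_w_flatten w bs : (forall b, b \in bs -> S_w w b) -> S_w w (flatten bs).
Proof.
elim: bs => [|b bs IH] H; first exact: S_w_nil.
apply: S_w_cat; first exact: (H b (mem_head b bs)).
by apply: IH => c cbs; apply: (H c); rewrite inE cbs orbT.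
Qed.

(* Merges (C1), where m = n and the occurrences are disjoint, with (C2). *)
Definition forced w v := exists m n s t t' s',
  [/\ S_w w s, S_w w s', w m = s ++ v ++ t, w n = t' ++ v ++ s' &
      m = n -> size s + size v <= size t'].

Lemma forced_S_w w v : forced w v -> S_w w v.
Proof.
move=> [m [n [s [t [t' [s' [Ss Ss' Em En le]]]]]]].
case: (eqVneq m n) => [mn|/eqP mn]; last exact: (S_w_C2 mn Em En).
have E : (s ++ v) ++ t = t' ++ v ++ s' by rewrite -catA -Em -En mn.
have [|e Et' _] := cat_eq_cat E; first by rewrite size_cat; exact: le.
by apply: (@S_w_C1 w n s v e s') => //; rewrite En Et' -!catA.
Qed.

(** By leastness of [S_w], applied to the predicate [P]. Keeping membership in [S_w] inside [P]
    makes every word produced by (C1) or (C2) forced. *)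
Lemma S_w_forced_product w x : S_w w x ->
  exists2 bs, (forall b, b \in bs -> forced w b) & x = flatten bs.
Proof.
pose P y := S_w w y /\ exists2 bs, (forall b, b \in bs -> forced w b) & y = flatten bs.
have PP y : forced w y -> P y.
  move=> fy; split; first exact: forced_S_w.
  by exists [:: y]; [move=> b; rewrite inE => /eqP-> | rewrite /= cats0].
move=> Sx; suff [] : P x by [].
apply: Sx.
- split; first by split; [exact: S_w_nil | exists [::]].
  move=> y z [Sy [bs Hbs Ey]] [Sz [cs Hcs Ez]]; split; first exact: S_w_cat.
  exists (bs ++ cs); last by rewrite flatten_cat Ey Ez.
  by move=> b; rewrite mem_cat => /orP[/Hbs|/Hcs].
- move=> n s v u s' E [Ss _] [Ss' _]; apply: PP.
  exists n, n, s, (u ++ v ++ s'), (s ++ v ++ u), s'; split => //.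
    by rewrite E -!catA.
  by rewrite !size_cat; lia.
- move=> m n s v t t' s' mn Em En [Ss _] [Ss' _]; apply: PP.
  by exists m, n, s, t, t', s'; split.
Qed.

Definition irreducible w b :=
  [/\ b <> [::], S_w w b &
      forall x y, b = x ++ y -> S_w w x -> S_w w y -> x = [::] \/ y = [::]].

(** In a product of forced words equal to [b], irreducibility leaves only one nonempty factor. *)
Lemma irreducible_forced w b : irreducible w b -> forced w b.
Proof.
move=> [b0 Sb irr]; have [bs Hbs Eb] := S_w_forced_product Sb.
elim: bs Hbs Eb => [|c bs IH] Hbs Eb //.
have fc : forced w c by exact/(Hbs c)/mem_head.
have Hbs' d : d \in bs -> forced w d by move=> h; apply: (Hbs d); rewrite inE h orbT.
have Sbs : S_w w (flatten bs) by apply: S_w_flatten => d /Hbs'/forced_S_w.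
have [c0|bs0] := irr _ _ Eb (forced_S_w fc) Sbs.
  by apply: IH => //; rewrite Eb c0.
by have -> : b = c; rewrite // -[c]cats0 -bs0.
Qed.

Lemma S_w_irreducible_product w x : S_w w x ->
  exists2 bs, (forall b, b \in bs -> irreducible w b) & x = flatten bs.
Proof.
have [k] := ubnP (size x); elim: k x => // k IH x lek Sx.
have [->|/eqP x0] := eqVneq x [::]; first by exists [::].
have [irr|nirr] := pselect (irreducible w x).
  by exists [:: x]; [move=> b; rewrite inE => /eqP-> | rewrite /= cats0].
have [y [z [Exyz Sy Sz y0 z0]]] : exists y z,
    [/\ x = y ++ z, S_w w y, S_w w z, y <> [::] & z <> [::]].
  apply: contrapT => H; apply: nirr; split => // y z E Sy Sz.
  apply: contrapT => H'; apply: H; exists y, z; split => // h; apply: H';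
  by [left | right].
have [sy sz] := (size_gt0 y0, size_gt0 z0).
move: lek; rewrite Exyz size_cat => lek.
have [||bs Hbs ->] := IH y; [lia | by [] |].
have [||cs Hcs ->] := IH z; [lia | by [] |].
exists (bs ++ cs); last by rewrite flatten_cat.
by move=> b; rewrite mem_cat => /orP[/Hbs|/Hcs].
Qed.

(** In the first forced occurrence [y] follows [s ++ x], in the second it precedes [s']; so [y] is
    forced too and the product splits in [S_w]. *)
Lemma irreducible_prefix w x y : irreducible w (x ++ y) -> S_w w x -> x <> [::] -> y = [::].
Proof.
move=> irr Sx x0; have [m [n [s [t [t' [s' [Ss Ss' Em En le]]]]]]] := irreducible_forced irr.
have Sy : S_w w y.
  apply: forced_S_w; exists m, n, (s ++ x), t, (t' ++ x), s'; split; rewrite ?Em ?En -?catA //.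
    exact: S_w_cat.
  by move=> /le; rewrite !size_cat; lia.
by case: irr => _ _ /(_ x y erefl Sx Sy) [].
Qed.

Lemma irreducible_suffix w x y : irreducible w (x ++ y) -> S_w w y -> y <> [::] -> x = [::].
Proof.
move=> irr Sy y0; have [m [n [s [t [t' [s' [Ss Ss' Em En le]]]]]]] := irreducible_forced irr.
have Sx : S_w w x.
  apply: forced_S_w; exists m, n, s, (y ++ t), t', (y ++ s'); split; rewrite ?Em ?En -?catA //.
    exact: S_w_cat.
  by move=> /le; rewrite !size_cat; lia.
by case: irr => _ _ /(_ x y erefl Sx Sy) [].
Qed.

(* [inl c] is the letter c of A, and [inr b] a formal inverse of the word b. *)
Notation letter := (bool + word)%type.

Definition pos (x : word) : seq letter := map inl x.

Lemma pos_cat x y : pos (x ++ y) = pos x ++ pos y.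
Proof. exact: map_cat. Qed.

Lemma pos_rcons x c : pos (rcons x c) = rcons (pos x) (inl c).
Proof. exact: map_rcons. Qed.

Lemma cat_pos_inv (g g' : seq letter) y b : g ++ pos y = g' ++ inr b :: pos b ->
  exists2 x, b = x ++ y & g = g' ++ inr b :: pos x.
Proof.
suff H c : g ++ pos y = g' ++ inr c :: pos b ->
  exists2 x, b = x ++ y & g = g' ++ inr c :: pos x by move/H.
elim/last_ind: y b => [|y a IH] b; first by rewrite cats0 => ->; exists b; rewrite ?cats0.
case/lastP: b => [|b a']; first by rewrite pos_rcons -rcons_cat cats1 => /rcons_inj[].
rewrite !pos_rcons -rcons_cat -rcons_cons -rcons_cat => /rcons_inj[/IH[x -> ->] <-].
by exists x; rewrite // rcons_cat.
Qed.

Lemma cat_pos_pos (g h : seq letter) y v : g ++ pos y = h ++ pos v ->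
  (exists2 x, v = x ++ y & g = h ++ pos x) \/ (exists2 x, y = x ++ v & h = g ++ pos x).
Proof.
elim/last_ind: y v => [|y a IH] v; first by rewrite cats0 => ->; left; exists v; rewrite ?cats0.
case/lastP: v => [|v a'].
  by rewrite cats0 => <-; right; exists (rcons y a); rewrite ?cats0.
rewrite !pos_rcons -!rcons_cat => /rcons_inj[/IH[[x -> ->]|[x -> ->]] <-].
  by left; exists x; rewrite // rcons_cat.
by right; exists x; rewrite // rcons_cat.
Qed.

(** Both sides display the last inverse letter of the word, so the cancellation at the end of a word
    is unambiguous. *)
Lemma cat_pos_inv_uniq (g g' : seq letter) b b' y :
  g ++ inr b :: pos y = g' ++ inr b' :: pos b' -> [/\ g = g', b = b' & y = b'].
Proof.
rewrite -cat1s catA => /cat_pos_inv[x]; rewrite cats1.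
case/lastP: x => [|x a] Eb; first by rewrite cats1 => /rcons_inj[-> ->].
by rewrite pos_rcons -rcons_cons -rcons_cat => /rcons_inj.
Qed.

Lemma nilVneq (T : Type) (x : seq T) : x = [::] \/ x <> [::].
Proof. by case: x; [left | right]. Qed.

Section Action.
Variables (w p s u : nat -> word).
Hypothesis noncov : forall n, ~ exists s0 t v : word,
       w n = s0 ++ t ++ v /\ S_w w (s0 ++ t) /\ S_w w (t ++ v).
Hypothesis pP : forall n, prefix (p n) (w n) /\ S_w w (p n) /\
     forall q, prefix q (w n) -> S_w w q -> size q <= size (p n).
Hypothesis sP : forall n, suffix (s n) (w n) /\ S_w w (s n) /\
     forall q, suffix q (w n) -> S_w w q -> size q <= size (s n).
Hypothesis wE : forall n, w n = p n ++ u n ++ s n.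
Hypothesis uP : forall n m, infix (u n) (w m) <-> n = m.
Hypothesis u_p : forall n, ~ infix (u n) (p n).

(** * Occurrences of irreducible elements and of the words [u n] inside the words [w m] *)

Lemma u_neq0 n : u n <> [::].
Proof. by move=> E; apply: (u_p (n := n)); rewrite E infix0s. Qed.

(** Otherwise [a] and [b] cover [w n] with a possibly empty overlap [e], against [noncov]. *)
Lemma size_prefix_suffix n a t t' b : w n = a ++ t -> w n = t' ++ b ->
  S_w w a -> S_w w b -> size a < size t'.
Proof.
move=> Ea Eb Sa Sb; rewrite ltnNge; apply/negP => le.
have E : t' ++ b = a ++ t by rewrite -Ea -Eb.
have [e Ea' Eb'] := cat_eq_cat E le.
by apply: (noncov (n := n)); exists t', e, t; rewrite -Ea' -Eb' Eb.
Qed.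

Lemma size_le_p n q t : w n = q ++ t -> S_w w q -> size q <= size (p n).
Proof.
by move=> E Sq; case: (pP n) => _ [_]; apply=> //; apply/prefixP; exists t.
Qed.

Lemma size_le_s n q t : w n = t ++ q -> S_w w q -> size q <= size (s n).
Proof.
by move=> E Sq; case: (sP n) => _ [_]; apply=> //; apply/suffixP; exists t.
Qed.

Lemma S_w_p n : S_w w (p n). Proof. by case: (pP n) => _ []. Qed.

Lemma S_w_s n : S_w w (s n). Proof. by case: (sP n) => _ []. Qed.

(** If [m <> n], (C2) puts [v] itself in [S_w]. If [m = n], the two occurrences of [v] may overlap,
    but a short border of [v] occurs disjointly at their outer ends, and (C1) applies to it. *)
Lemma S_w_border m n a v t t' b : v <> [::] ->
  w m = a ++ v ++ t -> w n = t' ++ v ++ b -> S_w w a -> S_w w b ->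
  (m = n -> size a < size t') ->
  exists v0 c d, [/\ v0 <> [::], S_w w v0, v = v0 ++ c & v = d ++ v0].
Proof.
move=> v0 Em En Sa Sb lt.
case: (eqVneq m n) => [mn|/eqP mn]; last first.
  by exists v, [::], [::]; rewrite cats0; split => //; apply: (S_w_C2 mn Em En).
subst m; have lt' := lt erefl; have E : a ++ (v ++ t) = t' ++ (v ++ b) by rewrite -Em -En.
have [d Et' Ed] := cat_eq_cat E (ltnW lt').
have d0 : d <> [::] by move=> d0; move: lt'; rewrite Et' d0 cats0 ltnn.
have [|t1 Edv Et] := cat_eq_cat (etrans Ed (catA d v b)); first by rewrite size_cat leq_addl.
have [x [k [c [e [x0 E1 E2 E3]]]]] := disjoint_border v0 d0 (esym Edv).
exists x, c, e; split => //.
apply: (@S_w_C1 w n a x k b) => //.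
by rewrite Em Et (catA v) E3 -!catA.
Qed.

(** The word [y] also ends a forced occurrence of [x ++ y] followed by an element of [S_w], so
    [S_w_border] gives a nonempty suffix of [x ++ y] in [S_w], which must be the whole word. *)
Lemma irreducible_overlap m x y a t : irreducible w (x ++ y) -> y <> [::] ->
  w m = a ++ y ++ t -> S_w w a -> x = [::].
Proof.
move=> irr y0 Em Sa.
have [_ [n [_ [_ [t' [b [_ Sb _ En _]]]]]]] := irreducible_forced irr.
have [||v0 [c [d [v00 Sv0 _ E2]]]] := S_w_border y0 Em (_ : w n = (t' ++ x) ++ y ++ b) Sa Sb.
- by rewrite En -!catA.
- move=> mn; subst m; rewrite size_cat; apply: ltn_addr.
  apply: (size_prefix_suffix Em En Sa); apply: S_w_cat => //.
  by case: irr.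
move: irr; rewrite E2 catA => irr.
by have := irreducible_suffix irr Sv0 v00; case: (x).
Qed.

(** Both forced occurrences of [b] would lie in [w n]; the first ends a prefix of [w n] in [S_w],
    hence lies within [p n], which does not contain [u n]. *)
Lemma irreducible_no_u b n : irreducible w b -> ~ infix (u n) b.
Proof.
move=> irr ub; have [m [k [a [t [t' [b' [Sa Sb' Em Ek le]]]]]]] := irreducible_forced irr.
have /uP nm : infix (u n) (w m) by rewrite Em; apply: infix_trans ub (infix_cat3 _ _ _).
have /uP nk : infix (u n) (w k) by rewrite Ek; apply: infix_trans ub (infix_cat3 _ _ _).
subst m k; have Sab : S_w w (a ++ b) by apply: S_w_cat => //; case: irr.
have Ew : w n = (a ++ b) ++ t by rewrite Em catA.
have := wE n; rewrite Ew => E'.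
have [e Ep _] := cat_eq_cat E' (size_le_p Ew Sab).
by apply: (u_p (n := n)); rewrite Ep -catA; apply: infix_trans ub (infix_cat3 _ _ _).
Qed.

(** In [w m] the word [y] precedes [s m], so a border of [y] in [S_w] would give a suffix longer
    than [s m]. This excludes jumps whose [u m] lies partly in the state and partly in the letters
    read. *)
Lemma u_no_split m n a x y t : u m = x ++ y -> x <> [::] -> y <> [::] ->
  w n = a ++ y ++ t -> ~ S_w w a.
Proof.
move=> Eu x0 y0 En Sa.
have Em : w m = (p m ++ x) ++ y ++ s m by rewrite wE Eu -!catA.
have [|v0 [c [d [v00 Sv0 _ E2]]]] := S_w_border y0 En Em Sa (S_w_s m).
  move=> nm; subst n; apply: leq_ltn_trans (size_le_p En Sa) _.
  by rewrite size_cat; have := size_gt0 x0; lia.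
have := @size_le_s m (v0 ++ s m) (p m ++ x ++ d).
rewrite Em E2 -!catA => /(_ erefl (S_w_cat Sv0 (S_w_s m))).
by rewrite size_cat; have := size_gt0 v00; lia.
Qed.

(** As [y] would follow [p n] in [w n], [irreducible_overlap] makes it an element of [S_w], and
    [p n ++ y] is then too long a prefix. This excludes cancellations while [u n] is read. *)
Lemma u_no_irreducible n x y t : irreducible w (x ++ y) -> y <> [::] ->
  u n <> y ++ t.
Proof.
move=> irr y0 Eu.
have En : w n = p n ++ y ++ (t ++ s n) by rewrite wE Eu -!catA.
have x0 := irreducible_overlap irr y0 En (S_w_p n); subst x.
have Sy : S_w w y by case: irr.
have := @size_le_p n (p n ++ y) (t ++ s n).
rewrite En -!catA => /(_ erefl (S_w_cat (S_w_p n) Sy)).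
by rewrite size_cat; have := size_gt0 y0; lia.
Qed.

Lemma u_infix_eq n m x y : u n = x ++ u m ++ y -> n = m.
Proof.
move=> E; apply/esym/uP; rewrite wE E; apply: infix_trans (infix_cat3 (p n) _ (s n)).
exact: infix_cat3.
Qed.

(** * The action on reduced words *)

Variable R : Type.
Notation state := (R * seq letter)%type.

(** Through [bad_label], being reduced also requires the labels of inverse letters to be
    irreducible. *)
Inductive bad : seq letter -> Prop :=
| bad_label b : ~ irreducible w b -> bad [:: inr b]
| bad_inv_pos b : bad (inr b :: pos b)
| bad_pos_inv b : bad (rcons (pos b) (inr b))
| bad_u n : bad (pos (u n)).

Definition reduced (g : seq letter) := forall x v y, g = x ++ v ++ y -> ~ bad v.

Lemma bad_neq0 v : bad v -> v <> [::].
Proof.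
case=> // [b|n]; first by case: b.
by move/(congr1 size); rewrite size_map => /size0nil; exact: u_neq0.
Qed.

Lemma reduced_nil : reduced [::].
Proof. by move=> [|//] [|//] y _ /bad_neq0. Qed.

Lemma reduced_catl g h : reduced (g ++ h) -> reduced g.
Proof. by move=> gh x v y E; apply: (gh x v (y ++ h)); rewrite E -!catA. Qed.

Lemma reduced_rcons g a : reduced g ->
  (forall x v, rcons g a = x ++ v -> ~ bad v) -> reduced (rcons g a).
Proof.
move=> gr H x v y; case/lastP: y => [|y a']; first by rewrite cats0; exact: H.
by rewrite -!rcons_cat => /rcons_inj[E _]; exact: gr E.
Qed.

Lemma reduced_rcons_pos g c : reduced g ->
  (forall g' b, rcons g (inl c) <> g' ++ inr b :: pos b) ->
  (forall h n, rcons g (inl c) <> h ++ pos (u n)) -> reduced (rcons g (inl c)).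
Proof.
move=> gr H1 H2; apply: reduced_rcons => // x v E bv; case: bv E.
- by move=> b _; rewrite cats1 => /rcons_inj.
- by move=> b /H1.
- by move=> b; rewrite -rcons_cat => /rcons_inj.
- by move=> n /H2.
Qed.

Definition back (b : word) (z : state) : state :=
  (z.1, if suffix (pos b) z.2 then take (size z.2 - size b) z.2 else rcons z.2 (inr b)).

Arguments back : simpl never.

(** The right fold undoes the last factor first, as for the inverse of a product. *)
Definition backs (z : state) (bs : seq word) : state := foldr back z bs.

Lemma backE b r g : back b (r, g) =
  (r, if suffix (pos b) g then take (size g - size b) g else rcons g (inr b)).
Proof. by []. Qed.

Lemma back_cat b r g : back b (r, g ++ pos b) = (r, g).
Proof.
by rewrite backE suffix_suffix size_cat size_map addnK take_size_cat.
Qed.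

Lemma back_rcons b r g : ~~ suffix (pos b) g -> back b (r, g) = (r, rcons g (inr b)).
Proof. by rewrite backE => /negbTE->. Qed.

Lemma reduced_back b z : irreducible w b -> reduced z.2 -> reduced (back b z).2.
Proof.
move=> irr; case: z => r g gr; rewrite /= in gr.
have [/suffixP[g' E]|ns] := boolP (suffix (pos b) g).
  by subst g; rewrite back_cat; apply: reduced_catl gr.
rewrite (back_rcons r ns) /=; apply: reduced_rcons => // x v E bv; case: bv E.
- by move=> b' nirr; rewrite cats1 => /rcons_inj[_ E]; apply: nirr; rewrite -E.
- move=> b'; case/lastP: b' => [|b' c].
    by rewrite cats1 => /rcons_inj[_ E]; case: irr; rewrite E.
  by rewrite pos_rcons -rcons_cons -rcons_cat => /rcons_inj.
- move=> b'; rewrite -rcons_cat => /rcons_inj[E Eb]; move/negP: ns; apply.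
  by rewrite Eb E suffix_suffix.
- move=> n; case/lastP E: (u n) => [|y c]; first by case: (u_neq0 E).
  by rewrite pos_rcons -rcons_cat => /rcons_inj.
Qed.

Lemma reduced_backs bs z : (forall b, b \in bs -> irreducible w b) ->
  reduced z.2 -> reduced (backs z bs).2.
Proof.
move=> + zr; elim: bs => //= b bs IH H; apply: reduced_back.
  exact: (H b (mem_head b bs)).
by apply: IH => c cbs; apply: (H c); rewrite inE cbs orbT.
Qed.

Variables (P Q : nat -> seq word).
Hypothesis P_irr : forall n b, b \in P n -> irreducible w b.
Hypothesis PE : forall n, p n = flatten (P n).
Hypothesis Q_irr : forall n b, b \in Q n -> irreducible w b.
Hypothesis QE : forall n, s n = flatten (Q n).
Variable F : nat -> state -> state.
Hypothesis F_reduced : forall n z, reduced z.2 -> reduced (F n z).2.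

Definition jump n (z : state) : state := backs (F n (backs z (P n))) (Q n).

Lemma reduced_jump n z : reduced z.2 -> reduced (jump n z).2.
Proof.
by move=> zr; apply/(reduced_backs (@Q_irr n))/F_reduced/(reduced_backs (@P_irr n)).
Qed.

Definition step (z : state) (c : bool) : state :=
  match pselect (exists gb, rcons z.2 (inl c) = gb.1 ++ inr gb.2 :: pos gb.2) with
  | left h => (z.1, (projT1 (cid h)).1)
  | right _ =>
    match pselect (exists hn, rcons z.2 (inl c) = hn.1 ++ pos (u hn.2)) with
    | left h => let hn := projT1 (cid h) in jump hn.2 (z.1, hn.1)
    | right _ => (z.1, rcons z.2 (inl c))
    end
  end.

Variant step_spec r g c : state -> Prop :=
| StepReduce g' b of rcons g (inl c) = g' ++ inr b :: pos b : step_spec r g c (r, g')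
| StepJump h n of (forall g' b, rcons g (inl c) <> g' ++ inr b :: pos b) &
    rcons g (inl c) = h ++ pos (u n) : step_spec r g c (jump n (r, h))
| StepAppend of (forall g' b, rcons g (inl c) <> g' ++ inr b :: pos b) &
    (forall h n, rcons g (inl c) <> h ++ pos (u n)) : step_spec r g c (r, rcons g (inl c)).

Lemma stepP r g c : step_spec r g c (step (r, g) c).
Proof.
rewrite /step /=; case: pselect => [h|nr].
  by case: cid => -[g' b] /= E; apply: StepReduce E.
have nr' g' b : rcons g (inl c) <> g' ++ inr b :: pos b.
  by move=> E; apply: nr; exists (g', b).
case: pselect => [h|nu].
  by case: cid => -[h' n] /= E; apply: StepJump.
by apply: StepAppend => // h n E; apply: nu; exists (h, n).
Qed.

Lemma step_reduce r g c g' b : rcons g (inl c) = g' ++ inr b :: pos b ->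
  step (r, g) c = (r, g').
Proof.
move=> E; case: stepP => [g1 b1|h n /(_ _ _ E)|/(_ _ _ E)] //.
by rewrite E => /cat_pos_inv_uniq[->].
Qed.

(** Of two words [u n] and [u n1] ending the same word, one is a suffix of the other, so
    [u_infix_eq] identifies the indices. *)
Lemma step_jump r g c h n : (forall g' b, rcons g (inl c) <> g' ++ inr b :: pos b) ->
  rcons g (inl c) = h ++ pos (u n) -> step (r, g) c = jump n (r, h).
Proof.
move=> nr E; case: stepP => [g1 b1 /nr|h1 n1 _|_ /(_ _ _ E)] //.
rewrite E => E1.
have Enn : n = n1.
  case: (cat_pos_pos E1) => -[x Ex _].
    by symmetry; apply: (u_infix_eq (x := x) (y := [::])); rewrite cats0.
  by apply: (u_infix_eq (x := x) (y := [::])); rewrite cats0.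
subst n1; congr (jump n (r, _)).
by have := congr1 (take (size h)) E1; rewrite take_size_cat // => ->;
   rewrite take_size_cat //; have := congr1 size E1; rewrite !size_cat => /addIn.
Qed.

Lemma reduced_step z c : reduced z.2 -> reduced (step z c).2.
Proof.
case: z => r g /= gr; case: stepP => [g' b|h n nr|nr nu] /=.
- case/lastP: b => [|b c']; first by rewrite cats1 => /rcons_inj.
  by rewrite pos_rcons -rcons_cons -rcons_cat => /rcons_inj[E _]; move: gr; rewrite E => /reduced_catl.
- case/lastP E: (u n) => [|y c']; first by case: (u_neq0 E).
  rewrite pos_rcons -rcons_cat => /rcons_inj[Eg _]; apply: reduced_jump => /=.
  by move: gr; rewrite Eg => /reduced_catl.
- exact: reduced_rcons_pos.
Qed.

(** * Runs: where cancellations and jumps occur while a word is read *)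

Definition run (z : state) (x : word) : state := foldl step z x.

Lemma run_cat z x y : run z (x ++ y) = run (run z x) y.
Proof. exact: foldl_cat. Qed.

Lemma reduced_run z x : reduced z.2 -> reduced (run z x).2.
Proof. by elim: x z => //= c x IH z zr; apply/IH/reduced_step. Qed.

Lemma run_append r g y :
  (forall y1 y2 g' b, y = y1 ++ y2 -> y1 <> [::] -> g ++ pos y1 <> g' ++ inr b :: pos b) ->
  (forall y1 y2 h n, y = y1 ++ y2 -> y1 <> [::] -> g ++ pos y1 <> h ++ pos (u n)) ->
  run (r, g) y = (r, g ++ pos y).
Proof.
elim/last_ind: y => [|y c IH] nr nu; first by rewrite cats0.
rewrite -cats1 run_cat IH; last 2 first.
- by move=> y1 y2 g' b E; apply: (nr _ (rcons y2 c)); rewrite E rcons_cat.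
- by move=> y1 y2 h n E; apply: (nu _ (rcons y2 c)); rewrite E rcons_cat.
rewrite /= cats1 pos_rcons -rcons_cat.
have yc0 : rcons y c <> [::] by case: (y).
have yE : rcons y c = rcons y c ++ [::] by rewrite cats0.
case: stepP => // [g' b|h n _]; rewrite rcons_cat -pos_rcons => E.
  by case: (nr _ _ _ _ yE yc0 E).
by case: (nu _ _ _ _ yE yc0 E).
Qed.

Lemma run_append_reduced r g y : reduced (g ++ pos y) -> run (r, g) y = (r, g ++ pos y).
Proof.
move=> gr; apply: run_append => y1 y2 x z Ey _ E.
  apply: (gr x (inr z :: pos z) (pos y2)); last exact: bad_inv_pos.
  by rewrite Ey pos_cat catA E -catA.
apply: (gr x (pos (u z)) (pos y2)); last exact: bad_u.
by rewrite Ey pos_cat catA E -catA.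
Qed.

Lemma run_back b z : irreducible w b -> reduced z.2 -> run (back b z) b = z.
Proof.
move=> irr; case: z => r g gr; rewrite /= in gr.
have [/suffixP[g' E]|ns] := boolP (suffix (pos b) g).
  by subst g; rewrite back_cat run_append_reduced.
rewrite (back_rcons r ns).
case/lastP E: b irr => [|y c] irr; first by case: irr.
(* All of [y] is appended after the inverse letter, and the cancellation happens exactly at the last
   letter [c]. *)
rewrite -[in X in run _ X = _]cats1 run_cat run_append; last 2 first.
- move=> y1 y2 g' b' Ey _; rewrite cat_rcons => /cat_pos_inv_uniq[_ Eb' Eb].
  by have := congr1 size Ey; rewrite size_cat Eb -Eb' size_rcons; lia.
- move=> y1 y2 h n Ey _ /cat_pos_pos[[x Ex]|[x Ex _]].
    case/lastP: x Ex => [|x a] Ex; last by rewrite pos_rcons -rcons_cat => /rcons_inj.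
    by move=> _; apply: (irreducible_no_u (n := n) irr);
       rewrite Ex Ey -cats1 -catA; exact: (infix_cat3 [::]).
  apply: (irreducible_no_u (n := n) irr).
  by rewrite -cats1 Ey Ex -!catA; apply: infix_cat3.
by apply: (@step_reduce _ _ _ _ (rcons y c)); rewrite rcons_cat -pos_rcons cat_rcons.
Qed.

Lemma run_backs bs z : (forall b, b \in bs -> irreducible w b) -> reduced z.2 ->
  run (backs z bs) (flatten bs) = z.
Proof.
move=> + zr; elim: bs => //= b bs IH H.
have H' c : c \in bs -> irreducible w c by move=> cbs; apply: (H c); rewrite inE cbs orbT.
rewrite run_cat run_back; [exact: IH | exact: (H b (mem_head b bs)) |].
exact: reduced_backs.
Qed.

(** No jump occurs, by [u_no_split] and [irreducible_no_u]. If no cancellation occurs either, [b] is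
    appended and then removed. A cancelled label must be [b] itself, because irreducible elements
    neither overlap properly here nor are proper prefixes of each other. *)
Lemma back_run n a t b z : irreducible w b -> w n = a ++ b ++ t -> S_w w a ->
  reduced z.2 -> back b (run z b) = z.
Proof.
move=> irr En Sa; case: z => r g gr; rewrite /= in gr.
have no_u y1 y2 h m : b = y1 ++ y2 -> y1 <> [::] -> g ++ pos y1 <> h ++ pos (u m).
  move=> Eb y10; case/cat_pos_pos => -[x Ex Eg].
    case: (nilVneq x) => [x0|x0].
      apply: (irreducible_no_u (n := m) irr).
      by rewrite Ex x0 Eb; exact: (infix_cat3 [::]).
    apply: (u_no_split Ex x0 y10 (n := n) (t := y2 ++ t)) Sa.
    by rewrite En Eb -!catA.
  apply: (irreducible_no_u (n := m) irr).
  by rewrite Eb Ex -catA; exact: infix_cat3.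
have [[y1 [y2 [g' [c [Eb y10 Eg]]]]]|nr] := pselect (exists y1 y2 g' c,
    [/\ b = y1 ++ y2, y1 <> [::] & g ++ pos y1 = g' ++ inr c :: pos c]).
  have [x Ec Eg'] := cat_pos_inv Eg.
  have irrc : irreducible w c.
    apply: contrapT => nc; apply: (gr g' [:: inr c] (pos x)) => //.
    exact: bad_label.
  rewrite Ec in irrc.
  have x0 : x = [::].
    apply: (irreducible_overlap irrc y10 (m := n) (t := y2 ++ t) _ Sa).
    by rewrite En Eb -!catA.
  subst x; rewrite /= in Ec irrc; subst c.
  have y20 : y2 = [::].
    by rewrite Eb in irr; apply: (irreducible_prefix irr) => //; case: irrc.
  move: Eb; rewrite y20 cats0 => Eb; subst y1.
  (* As [g] is reduced, its final inverse letter is not preceded by [b]; so the state is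
     [back b (r, g')] and [run_back] applies. *)
  have ns : ~~ suffix (pos b) g'.
    apply/negP => /suffixP[g2 E2]; apply: (gr g2 (rcons (pos b) (inr b)) [::]).
      by rewrite Eg' E2 cats0 -rcons_cat cats1.
    exact: bad_pos_inv.
  have zE : (r, g) = back b (r, g') by rewrite (back_rcons r ns) Eg' cats1.
  rewrite zE run_back //=.
  by move: gr; rewrite Eg' => /reduced_catl.
rewrite run_append ?back_cat // => y1 y2 g' c Eb y10 Eg.
by apply: nr; exists y1, y2, g', c.
Qed.

Lemma backs_run n a t bs z : (forall b, b \in bs -> irreducible w b) ->
  w n = a ++ flatten bs ++ t -> S_w w a -> reduced z.2 ->
  backs (run z (flatten bs)) bs = z.
Proof.
elim: bs a z => //= b bs IH a z H En Sa zr.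
have irr : irreducible w b by exact: (H b (mem_head b bs)).
rewrite run_cat (IH (a ++ b)).
- by apply: (back_run irr _ Sa zr (n := n) (t := flatten bs ++ t)); rewrite En -!catA.
- by move=> c cbs; apply: (H c); rewrite inE cbs orbT.
- by rewrite En -!catA.
- by apply: S_w_cat => //; case: irr.
- exact: reduced_run.
Qed.

(** Cancellations are excluded by [u_no_irreducible]. An earlier jump would need either a proper
    suffix of some [u m] right after [p n], against [u_no_split], or some [u m] inside a proper
    prefix of [u n]. *)
Lemma run_u n z : reduced z.2 -> run z (u n) = jump n z.
Proof.
case: z => r h hr; rewrite /= in hr.
have nr y1 y2 g' b : u n = y1 ++ y2 -> y1 <> [::] -> h ++ pos y1 <> g' ++ inr b :: pos b.
  move=> Eu y10 /cat_pos_inv[x Eb Eh].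
  apply: (u_no_irreducible (n := n) (t := y2) _ y10 Eu (x := x)).
  rewrite -Eb; apply: contrapT => nb; apply: (hr g' [:: inr b] (pos x)) => //.
  exact: bad_label.
case/lastP E: (u n) => [|y c]; first by case: (u_neq0 E).
rewrite -cats1 run_cat run_append; last 2 first.
- by move=> y1 y2 g' b Ey; apply: (nr y1 (rcons y2 c)); rewrite E Ey rcons_cat.
- move=> y1 y2 h' m Ey y10; case/cat_pos_pos => -[x Ex Eh].
    case: (nilVneq x) => [x0|x0]; last first.
      apply: (u_no_split Ex x0 y10 (n := n) (t := rcons y2 c ++ s n)) (S_w_p n).
      by rewrite wE E Ey rcons_cat -!catA.
    have Eu : u n = [::] ++ u m ++ rcons y2 c by rewrite E Ex x0 Ey rcons_cat.
    have mn := u_infix_eq Eu; subst m.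
    by have := congr1 size Eu; rewrite !size_cat size_rcons /=; lia.
  have Eu : u n = x ++ u m ++ rcons y2 c by rewrite E Ey Ex rcons_cat -!catA.
  have mn := u_infix_eq Eu; subst m.
  by have := congr1 size Eu; rewrite !size_cat size_rcons; lia.
have E' : rcons (h ++ pos y) (inl c) = h ++ pos (u n) by rewrite E pos_rcons rcons_cat.
apply: step_jump => // g' b; rewrite E'.
by apply: (nr (u n) [::]); rewrite ?cats0 //; exact: u_neq0.
Qed.

(** The jump first undoes the reading of [p n], then applies [F n], and finally prepares a state
    from which reading [s n] leads back to the value of [F n]. *)
Lemma run_w n z : reduced z.2 -> run z (w n) = F n z.
Proof.
move=> zr; rewrite wE !run_cat run_u; last exact: reduced_run.
rewrite /jump [in X in backs X _]PE (backs_run (n := n) (a := [::]) (t := u n ++ s n)) //.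
- rewrite QE; apply: run_backs; [exact: Q_irr | exact: F_reduced].
- exact: P_irr.
- by rewrite wE PE.
- exact: S_w_nil.
Qed.

End Action.

(** * Transport of the action from reduced states to [X] *)

Theorem theorem3p2 (w : nat -> word) (p s u : nat -> word) :
  (forall n, w n <> [::]) ->
  (forall n, ~ exists s0 t v : word,
       w n = s0 ++ t ++ v /\ S_w w (s0 ++ t) /\ S_w w (t ++ v)) ->
  (* p n is the longest prefix of w n in S_w *)
  (forall n, prefix (p n) (w n) /\ S_w w (p n) /\
     forall q, prefix q (w n) -> S_w w q -> size q <= size (p n)) ->
  (* s n is the longest suffix of w n in S_w *)
  (forall n, suffix (s n) (w n) /\ S_w w (s n) /\
     forall q, suffix q (w n) -> S_w w q -> size q <= size (s n)) ->
  (forall n, w n = p n ++ u n ++ s n) ->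
  (forall n m, infix (u n) (w m) <-> n = m) ->
  (forall n, ~ infix (u n) (p n)) ->
  forall X : Type, infinite_type X -> universal_for_TX X w.
Proof.
move=> _ noncov pP sP wE uP u_p X Xinf f.
(* Stated for every word, with [[::]] as default outside [S_w], so that choice gives a total
   factorization function. *)
have dec x : exists bs, S_w w x -> (forall b, b \in bs -> irreducible w b) /\ x = flatten bs.
  case: (pselect (S_w w x)) => [/S_w_irreducible_product[bs Hbs ->]|nSx].
    by exists bs.
  by exists [::].
have /choice[D DP] := dec.
pose P n := D (p n); pose Q n := D (s n).
have PP n := DP _ (S_w_p pP n); have QP n := DP _ (S_w_s sP n).
have [phi [psi [phiA phiK psiK]]] :=
  infinite_prod_countable_bij (C := seq letter) (A := reduced w u) Xinf (reduced_nil u_p).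
pose F n z := phi (f n (psi z)).
have F_red n z : reduced w u z.2 -> reduced w u (F n z).2 by move=> _; exact: phiA.
exists (fun x a => psi (run u P Q F (phi a) x)); split.
  (* [phi] undoes [psi] on reduced states only, so the intermediate state must be shown reduced. *)
  move=> x y _ _; apply: funext => a; rewrite /tcomp run_cat psiK //.
  apply: (reduced_run u_p (fun n => proj1 (PP n)) (fun n => proj1 (QP n)) F_red).
  exact: phiA.
move=> n; apply: funext => a.
rewrite (run_w noncov pP sP wE uP u_p (fun n => proj1 (PP n)) (fun n => proj2 (PP n))
  (fun n => proj1 (QP n)) (fun n => proj2 (QP n)) F_red) ?/F ?phiK //.
Qed.
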